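(* Let $K = \langle S, AP, \to, L\rangle$ be a Kripke structure. Then for all states $s, s' \in S$: $s$ and $s'$ are bisimilar in $K$ if and only if $s$ and $s'$ are bisimilar in the labelled transition system $\mathsf{lts}(K)$.
   Context: A Kripke structure is $K=\langle S, AP, \to, L\rangle$ with $S$ a set of states, $AP$ a set of atomic propositions, $\to\,\subseteq S\times S$ a total transition relation (for every $s\in S$ there is $t\in S$ with $s\to t$), and $L: S\to 2^{AP}$ a state labelling. A labelled transition system (LTS) is $T=\langle S, Act, \to\rangle$ with $S$ a set of states, $Act$ a set of actions, a special silent action $\tau\notin Act$, and a transition relation $\to\,\subseteq S\times(Act\cup\{\tau\})\times S$ that is total (for every $s\in S$ there are $a\in Act$, $t\in S$ with $s\xrightarrow{a}t$). The embedding $\mathsf{lts}$: for a Kripke structure $K=\langle S,AP,\to,L\rangle$, $\mathsf{lts}(K)=\langle S', Act, \to'\rangle$ where $S' = S\cup\{\bar s \mid s\in S\}$ (each $\bar s$ a fresh state not in $S$), $Act = 2^{AP}\cup\{\bot\}$ with $\bot$ a fresh symbol, and $\to'$ is the smallest relation such that: $s\xrightarrow{\bot}\bar s$ for every $s\in S$; $\bar s\xrightarrow{L(s)} s$ for every $s\in S$; $s\xrightarrow{\tau}t$ whenever $s\to t$ and $L(s)=L(t)$; $s\xrightarrow{L(t)}t$ whenever $s\to t$ and $L(s)\neq L(t)$. Simulation in a Kripke structure: a relation $B\subseteq S\times S$ is a simulation iff for all $(s,s')\in B$: $L(s)=L(s')$, and for every $t$ with $s\to t$ there is $t'$ with $s'\to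 t'$ and $(t,t')\in B$. Simulation in an LTS: $B\subseteq S\times S$ is a simulation iff for all $(s,s')\in B$, all $a\in Act\cup\{\tau\}$ and all $t$ with $s\xrightarrow{a}t$ there is $t'$ with $s'\xrightarrow{a}t'$ and $(t,t')\in B$. In either setting, states $s,s'$ are bisimilar iff there is a symmetric simulation relation $B$ with $(s,s')\in B$. *)

(* Defs.v *)
From Corelib Require Import RelationClasses.
From mathcomp Require Import all_boot.
From mathcomp Require Import classical_sets.

Set Implicit Arguments.
Unset Strict Implicit.
Unset Printing Implicit Defensive.

Record kripke := Kripke {
  kstate : Type;
  AP : Type;
  kstep : kstate -> kstate -> Prop;
  label : kstate -> set AP;
  kstep_total : forall s, exists t, kstep s t
}.

Arguments kstep {k}.
Arguments label {k}.

(* [with_tau A] is the disjoint union of A and {tau}, so that the silent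
   action is not an element of A. *)
Inductive with_tau (A : Type) : Type :=
| tau
| visible of A.

Arguments tau {A}.

(* Totality asks for a visible action: the a in it ranges over Act, not over
   Act extended with tau. *)
Record lts := LTS {
  state : Type;
  act : Type;
  step : state -> with_tau act -> state -> Prop;
  step_total : forall s, exists (a : act) (t : state), step s (visible a) t
}.

Arguments step {l}.

Definition kripke_simulation (K : kripke)
    (B : kstate K -> kstate K -> Prop) : Prop :=
  forall s s', B s s' ->
    label s = label s' /\
    (forall t, kstep s t -> exists t', kstep s' t' /\ B t t').

Definition kripke_bisimilar (K : kripke) (s s' : kstate K) : Prop :=
  exists B, [/\ Symmetric B, kripke_simulation B & B s s'].

Definition lts_simulation (T : lts) (B : state T -> state T -> Prop) : Prop :=
  forall s s', B s s' ->
    forall (a : with_tau (act T)) t, step s a t ->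
      exists t', step s' a t' /\ B t t'.

Definition lts_bisimilar (T : lts) (s s' : state T) : Prop :=
  exists B, [/\ Symmetric B, lts_simulation B & B s s'].

Section Embedding.
Variable K : kripke.

Inductive emb_state : Type :=
| orig of kstate K
| bar of kstate K.

Inductive emb_act : Type :=
| labels of set (AP K)
| bot.

Inductive emb_step : emb_state -> with_tau emb_act -> emb_state -> Prop :=
| emb_bot s : emb_step (orig s) (visible bot) (bar s)
| emb_label s : emb_step (bar s) (visible (labels (label s))) (orig s)
| emb_tau s t : kstep s t -> label s = label t ->
    emb_step (orig s) tau (orig t)
| emb_vis s t : kstep s t -> label s <> label t ->
    emb_step (orig s) (visible (labels (label t))) (orig t).

Lemma emb_step_total s :
  exists (a : emb_act) (t : emb_state), emb_step s (visible a) t.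
Proof.
case: s => s; first by exists bot, (bar s); constructor.
by exists (labels (label s)), (orig s); constructor.
Qed.

Definition lts_of_kripke : lts := LTS emb_step_total.

End Embedding.

Arguments orig {K}.
Arguments bar {K}.
Arguments labels {K}.
Arguments bot {K}.

(* Main.v *)
From Stdlib Require Import Classical_Prop.
From Corelib Require Import RelationClasses.
From mathcomp Require Import all_boot.
Require Import Defs.

(** A step [s -> t] of the Kripke structure is visible or silent in its embedding
    according to whether the label changes, so bisimilar states must match it with
    a step of the same kind once they are known to carry equal labels. The detour
    through [bar s] makes the label of [s] observable: this is what gives equal
    labels in the direction from the transition system to the Kripke structure. *)

(** Barred states must be paired as well, since matching [bot] steps lead into them. *)
Inductive emb_lift (K : kripke) (B : kstate K -> kstate K -> Prop) :
    emb_state K -> emb_state K -> Prop :=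
| lift_orig s s' : B s s' -> emb_lift K B (orig s) (orig s')
| lift_bar s s' : B s s' -> emb_lift K B (bar s) (bar s').

Lemma emb_lift_sym (K : kripke) (B : kstate K -> kstate K -> Prop) :
  Symmetric B -> Symmetric (emb_lift K B).
Proof. by move=> symB _ _ [] s s' /symB; constructor. Qed.

Lemma emb_lift_simulation (K : kripke) (B : kstate K -> kstate K -> Prop) :
  kripke_simulation B -> lts_simulation (T := lts_of_kripke K) (emb_lift K B).
Proof.
move=> simB _ _ [] s s' Bss' a u /= su; have [eqL simS] := simB _ _ Bss'.
- inversion su as [r | | r t st eqLt | r t st neqLt]; subst.
  + by exists (bar s'); split; constructor.
  (* Labels agree on both [(s, s')] and [(t, t')], so the matching step is silent too. *)
  + have [t' [st' Btt']] := simS _ st; have [eqLtt' _] := simB _ _ Btt'.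
    exists (orig t'); split; last exact: lift_orig.
    by apply: emb_tau; rewrite // -eqL -eqLtt'.
  + have [t' [st' Btt']] := simS _ st; have [eqLtt' _] := simB _ _ Btt'.
    exists (orig t'); split; last exact: lift_orig.
    by rewrite eqLtt'; apply: emb_vis; rewrite // -eqL -eqLtt'.
- inversion su; subst; exists (orig s'); split; last exact: lift_orig.
  by rewrite eqL; apply: emb_label.
Qed.

Section Restriction.
Variables (K : kripke) (B : emb_state K -> emb_state K -> Prop).
Hypothesis simB : lts_simulation (T := lts_of_kripke K) B.

Lemma lts_simulation_label (s s' : kstate K) :
  B (orig s) (orig s') -> label s = label s'.
Proof.
move=> Bss'; have [u [su Bu]] := simB _ _ Bss' _ _ (emb_bot s).
(* The only [bot] step of [orig s'] ends in [bar s'], whose sole action is [label s']. *)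
inversion su; subst.
have [v [uv _]] := simB _ _ Bu _ _ (emb_label s).
by inversion uv.
Qed.

Lemma lts_simulation_restrict :
  kripke_simulation (fun s s' => B (orig s) (orig s')).
Proof.
move=> s s' Bss'; split=> [|t st]; first exact: lts_simulation_label.
(* Equality of label sets is undecidable in general, hence excluded middle. *)
have [eqL|neqL] := classic (label s = label t).
- have [u [su Bu]] := simB _ _ Bss' _ _ (emb_tau st eqL).
  by inversion su as [| | r t' st' |]; subst; exists t'.
- have [u [su Bu]] := simB _ _ Bss' _ _ (emb_vis st neqL).
  (* From an original state, a label action can only come from a Kripke step. *)
  by inversion su as [| | | r t' st']; subst; exists t'.
Qed.

End Restriction.

Theorem theorem3p9 (K : kripke) (s s' : kstate K) :
  kripke_bisimilar s s' <->
  lts_bisimilar (T := lts_of_kripke K) (orig s) (orig s').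
Proof.
split=> [[B [symB simB Bss']]|[B [symB simB Bss']]].
- exists (emb_lift K B); split; last exact: lift_orig.
  + exact: emb_lift_sym.
  + exact: emb_lift_simulation.
- exists (fun r r' => B (orig r) (orig r')); split=> //.
  + by move=> r r' /symB.
  + exact: lts_simulation_restrict.
Qed.
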